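(* Let $s:\mathbb{N}\to[0,1]$ be nondecreasing with $s(n)\to1$. Fix $\tau\in(0,1)$ and define $m_\tau(n)=\Omega_\tau(s(n))$. If there exists $N\ge 1$ such that $s(N-1)<\tau\le s(N)$, then $m_\tau$ jumps at $N$, i.e. $m_\tau(N-1)=0$ and $m_\tau(N)=1$. This can occur even when every increment is at most any prescribed $\epsilon>0$: for every $\tau\in(0,1)$ and every $\epsilon>0$ there is a nondecreasing $s:\mathbb{N}\to[0,1]$ with $s(n)\to1$ and $s(n)-s(n-1)\le\epsilon$ for all $n\ge1$, and an $N\ge1$ with $s(N-1)<\tau\le s(N)$.
   Context: For $\tau\in(0,1)$, $\Omega_\tau:[0,1]\to\mathbb{R}$ is the thresholded observation functional $\Omega_\tau(x)=0$ if $x<\tau$ and $\Omega_\tau(x)=1$ if $x\ge\tau$. $\mathbb{N}=\{0,1,2,\dots\}$. *)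

(* Defs.v *)
From HB Require Import structures.
From mathcomp Require Import all_boot all_order all_algebra.
From mathcomp Require Import all_classical all_reals all_analysis.
Import Order.TTheory GRing.Theory Num.Theory numFieldNormedType.Exports.

Set Implicit Arguments.
Unset Strict Implicit.
Unset Printing Implicit Defensive.

Local Open Scope ring_scope.

Definition Omega (R : realType) (tau : R) (x : {i01 R}) : R :=
  if x%:num < tau then 0 else 1.

Definition observed (R : realType) (tau : R) (s : nat -> {i01 R}) : nat -> R :=
  fun n => Omega tau (s n).

(* Only meaningful for [0 < N], since [0.-1 = 0]. *)
Definition jumps_at (R : realType) (m : nat -> R) (N : nat) : Prop :=
  m N.-1 = 0 /\ m N = 1.

(* Main.v *)
(** The ramp [min 1 (n * eps)] has increments at most [eps], starts below [tau]
and is eventually constant equal to [1]; the first index at which it reaches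
[tau] is therefore a jump index. *)
Require Import Defs.
From HB Require Import structures.
From mathcomp Require Import all_boot all_order all_algebra.
From mathcomp Require Import all_classical all_reals all_analysis.
From mathcomp Require Import lra.
Import Order.TTheory GRing.Theory Num.Theory numFieldNormedType.Exports.

Set Implicit Arguments.
Unset Strict Implicit.
Unset Printing Implicit Defensive.

Local Open Scope classical_set_scope.
Local Open Scope ring_scope.

(** The jump is just the two branches of [Omega] evaluated on either side of [tau]; how far [s]
    moves between them is irrelevant. So slow growth cannot prevent it: a line of slope [eps] capped
    at 1 starts at 0 and attains 1 after finitely many steps ([ramp_near1]), hence has a least index
    with value at least [tau], and that is the crossing. *)

Definition ramp (R : realType) (eps : R) (n : nat) : R :=
  Num.min 1 (n%:R * eps).

Lemma ramp_ge0 (R : realType) (eps : R) n : 0 < eps -> 0 <= ramp eps n.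
Proof. by move=> eps0; rewrite le_min ler01 mulr_ge0// ltW. Qed.

Lemma ramp_le1 (R : realType) (eps : R) n : ramp eps n <= 1.
Proof. by rewrite ge_min lexx. Qed.

Lemma ramp_nondecreasing (R : realType) (eps : R) :
  0 < eps -> nondecreasing_seq (ramp eps).
Proof.
move=> eps0 m n mn.
by rewrite /ramp le_min !ge_min lexx/= ler_wpM2r ?ler_nat ?orbT// ltW.
Qed.

(** The uncapped line gains exactly [eps], and the cap can only shorten a step; the cases are which
    of the two values are capped. *)
Lemma ramp_increment (R : realType) (eps : R) n :
  0 < eps -> ramp eps n.+1 - ramp eps n <= eps.
Proof.
move=> eps0; rewrite /ramp -natr1 mulrDl mul1r.
by case: (lerP 1 (n%:R * eps)); case: (lerP 1 (n%:R * eps + eps)); lra.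
Qed.

(** Archimedean property: the cap is active once [n] is at least [eps^-1]. Being an eventual
    equality, this yields both the limit and an index reaching [tau]. *)
Lemma ramp_near1 (R : realType) (eps : R) :
  0 < eps -> \forall n \near \oo, ramp eps n = 1.
Proof.
move=> eps0; near=> n; apply/min_idPl.
rewrite -ler_pdivrMr// div1r; near: n; exact: nbhs_infty_ger.
Unshelve. all: by end_near. Qed.

Theorem theorem6p8 (R : realType) :
  (forall s : nat -> {i01 R},
     nondecreasing_seq (fun n => (s n)%:num) ->
     (fun n => (s n)%:num) @ \oo --> (1 : R) ->
     forall tau : R, 0 < tau -> tau < 1 ->
     forall N : nat, (1 <= N)%N ->
       (s N.-1)%:num < tau -> tau <= (s N)%:num ->
       jumps_at (observed tau s) N)
  /\
  (forall tau : R, 0 < tau -> tau < 1 ->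
   forall eps : R, 0 < eps ->
   exists s : nat -> {i01 R},
     [/\ nondecreasing_seq (fun n => (s n)%:num),
         (fun n => (s n)%:num) @ \oo --> (1 : R),
         (forall n : nat, (1 <= n)%N -> (s n)%:num - (s n.-1)%:num <= eps)
       & exists N : nat,
           [/\ (1 <= N)%N, (s N.-1)%:num < tau & tau <= (s N)%:num]]).
Proof.
split=> [s _ _ tau _ _ N _ s_lt s_ge|tau tau0 tau1 eps eps0].
  by rewrite /jumps_at /observed /Omega s_lt ltNge s_ge.
pose s n : {i01 R} := Itv01 (ramp_ge0 n eps0) (ramp_le1 eps n).
have near1 := ramp_near1 eps0.
exists s; split.
- exact: ramp_nondecreasing.
- exact: cvg_near_cst.
- by case=> // n _; exact: ramp_increment.
have reach : exists n, tau <= ramp eps n.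
  by have [n _ /(_ n (leqnn n)) /= n1] := near1; exists n; rewrite n1 ltW.
have s0 : ramp eps 0 < tau by rewrite /ramp mul0r min_r.
(* The least index is not 0 by [s0], so it has a true predecessor, which lies below [tau] by
   minimality. *)
case: (ex_minnP reach) => -[|N] tauN minN; first by move: s0; rewrite ltNge tauN.
by exists N.+1; split=> //=; rewrite ltNge; apply/negP => /minN; rewrite ltnn.
Qed.
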